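(* Assume (A1) with $\Omega\supseteq B(x^*,\delta)$, (A2), (A3), (A4) with exponent $r\in(0,1]$, and $\operatorname{rank}J(x)=\operatorname{rank}J(x^* )\ge1$ for all $x\in B(x^*,\delta)$. Let $\{x_k\}$ be generated by LMMSS with $\alpha_k=1$ and $\lambda_k=\|J_k^TF_k\|$ for all $k$. Then there exists $\varepsilon>0$ such that, if $x_0\in B(x^*,\varepsilon)$, the sequence $\{\operatorname{dist}(x_k,X^* )\}$ converges to zero superlinearly (more precisely $\operatorname{dist}(x_{k+1},X^* )\le K\operatorname{dist}(x_k,X^* )^{1+r}$ for a constant $K$, hence quadratically when $r=1$), and $\{x_k\}$ converges to a point of $X^*\cap B(x^*,\delta/2)$.
   Context: Let $F:\mathbb{R}^n\to\mathbb{R}^m$ be twice continuously differentiable with $m\ge n$, $J(x)$ its Jacobian, $\phi(x)=\tfrac12\|F(x)\|^2$, $\nabla\phi(x)=J(x)^TF(x)$. Norms are Euclidean/spectral. $X^*=\{x: J(x)^TF(x)=0\}\neq\emptyset$; $\operatorname{dist}(x,X^* )=\inf_{z\in X^*}\|x-z\|$. Fix $x^*\in X^*$; $B(x^*,\delta)$ is the closed ball. $L\in\mathbb{R}^{p\times n}$ has rank $p\le n$. LMMSS iteration: given $x_k$ and $\lambda_k>0$, with $F_k=F(x_k)$, $J_k=J(x_k)$, let $d_k$ solve $(J_k^TJ_k+\lambda_kL^TL)d_k=-J_k^TF_k$ and $x_{k+1}=x_k+\alpha_kd_k$. (A1) there are $\Omega$ and $\gamma>0$ with $\|J(x)v\|^2+\|Lv\|^2\ge\gamma\|v\|^2$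 for $x\in\Omega$, all $v$. (A2) $\delta\in(0,1)$, $L_0>0$ with $\|J(x)-J(y)\|\le L_0\|x-y\|$ on $B(x^*,\delta)$. (A3) $\omega>0$ with $\omega\operatorname{dist}(x,X^* )\le\|J(x)^TF(x)\|$ on $B(x^*,\delta)$. (A4) $r\in(0,1]$, $C\ge0$ with $\|(J(x)-J(z))^TF(z)\|\le C\|x-z\|^{1+r}$ for $x\in B(x^*,\delta)$, $z\in X^*\cap B(x^*,\delta)$. *)

(* Defs.v *)
From HB Require Import structures.
From mathcomp Require Import all_boot all_order all_algebra.
From mathcomp Require Import all_classical all_reals all_analysis.
Set Implicit Arguments. Unset Strict Implicit. Unset Printing Implicit Defensive.
Import Order.TTheory GRing.Theory Num.Theory.
Import numFieldNormedType.Exports.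
Local Open Scope classical_set_scope.
Local Open Scope ring_scope.

Section LMMDefs.
Variable R : realType.

Definition enorm (n : nat) (v : 'cV[R]_n) : R :=
  Num.sqrt (\sum_(i < n) (v i 0) ^+ 2).

Definition opnorm (m n : nat) (A : 'M[R]_(m, n)) : R :=
  sup [set enorm (A *m v) | v in [set v : 'cV[R]_n | enorm v <= 1]].

Definition ebasis (n : nat) (j : 'I_n) : 'cV[R]_n := delta_mx j 0.

Definition pderiv (n : nat) (f : 'cV[R]_n -> R) (j : 'I_n) : 'cV[R]_n -> R :=
  fun x => 'D_(ebasis j) f x.

Definition compF (n m : nat) (F : 'cV[R]_n -> 'cV[R]_m) (i : 'I_m) : 'cV[R]_n -> R :=
  fun x => F x i 0.

Definition C2 (n m : nat) (F : 'cV[R]_n -> 'cV[R]_m) : Prop :=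
  forall i : 'I_m,
    continuous (compF F i) /\
    forall j : 'I_n,
      (forall x, derivable (compF F i) x (ebasis j)) /\
      continuous (pderiv (compF F i) j) /\
      forall k : 'I_n,
        (forall x, derivable (pderiv (compF F i) j) x (ebasis k)) /\
        continuous (pderiv (pderiv (compF F i) j) k).

Definition jacF (n m : nat) (F : 'cV[R]_n -> 'cV[R]_m) (x : 'cV[R]_n)
  : 'M[R]_(m, n) :=
  \matrix_(i < m, j < n) pderiv (compF F i) j x.

Definition Xstar (n m : nat) (F : 'cV[R]_n -> 'cV[R]_m) : set 'cV[R]_n :=
  [set x | (jacF F x)^T *m F x = 0].

Definition distS (n : nat) (S : set 'cV[R]_n) (x : 'cV[R]_n) : R :=
  inf [set enorm (x - z) | z in S].

Definition cball (n : nat) (c : 'cV[R]_n) (r : R) : set 'cV[R]_n :=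
  [set x | enorm (x - c) <= r].

End LMMDefs.

(* Main.v *)
(** Let [g = J^T F], let [D] be the distance to [Xstar], and write [d] for the step
    at [x].  Since the rank of [J] is constant near [xs], a fixed complement [W]
    of [ker J(xs)] is also a complement of [ker J(x)], on which [J(x)] is
    uniformly bounded below.  Writing [d = w + k] along [W + ker J(x)] and testing
    the normal equation with [k] and with [d] gives [|k| <= c |w|] (by (A1)) and
    [|w| <= c |g(x)| <= c D(x)], so steps are [O(D)] even though the regularisation
    is singular.  In [g(x + d)] the first-order part cancels up to
    [lam L^T L d = O(D^2)], and (A4) at a nearly closest point [z] of [Xstar] handles
    the variation of [J] against [F z]; this leaves [O(D^(1 + r))].  The error
    bound (A3) turns this into the decrease of [D], and summing the steps gives
    convergence. *)

Require Import Defs.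
From HB Require Import structures.
From mathcomp Require Import all_boot all_order all_algebra.
From mathcomp Require Import all_classical all_reals all_analysis.
From mathcomp Require Import ring lra.
Import Order.TTheory GRing.Theory Num.Theory.
Import numFieldNormedType.Exports.
Local Open Scope classical_set_scope.
Local Open Scope ring_scope.

(** * Inner product and Euclidean norm *)

Definition dot {R : realType} {n : nat} (u v : 'cV[R]_n) : R :=
  \sum_(i < n) u i 0 * v i 0.

Lemma dotC {R : realType} {n} (u v : 'cV[R]_n) : dot u v = dot v u.
Proof. by apply: eq_bigr => i _; rewrite mulrC. Qed.

Lemma dot0l {R : realType} {n} (u : 'cV[R]_n) : dot 0 u = 0.
Proof. by rewrite /dot big1// => i _; rewrite mxE mul0r. Qed.

Lemma dotDl {R : realType} {n} (u v w : 'cV[R]_n) :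
  dot (u + v) w = dot u w + dot v w.
Proof. by rewrite -big_split; apply: eq_bigr => i _; rewrite !mxE mulrDl. Qed.

Lemma dotZl {R : realType} {n} (a : R) (u w : 'cV[R]_n) :
  dot (a *: u) w = a * dot u w.
Proof. by rewrite /dot mulr_sumr; apply: eq_bigr => i _; rewrite !mxE mulrA. Qed.

Lemma dotNl {R : realType} {n} (u w : 'cV[R]_n) : dot (- u) w = - dot u w.
Proof. by rewrite -scaleN1r dotZl mulN1r. Qed.

Lemma dotDr {R : realType} {n} (u v w : 'cV[R]_n) :
  dot w (u + v) = dot w u + dot w v.
Proof. by rewrite dotC dotDl !(dotC w). Qed.

Lemma dotZr {R : realType} {n} (a : R) (u w : 'cV[R]_n) :
  dot w (a *: u) = a * dot w u.
Proof. by rewrite dotC dotZl (dotC w). Qed.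

Lemma dotNr {R : realType} {n} (u w : 'cV[R]_n) : dot w (- u) = - dot w u.
Proof. by rewrite dotC dotNl (dotC w). Qed.

Lemma dot_mulmxr {R : realType} {m n} (A : 'M[R]_(m, n)) u v :
  dot u (A *m v) = dot (A^T *m u) v.
Proof.
have dotE k (a b : 'cV[R]_k) : dot a b = (a^T *m b) 0 0.
  by rewrite mxE; apply: eq_bigr => i _; rewrite mxE.
by rewrite !dotE trmx_mul trmxK mulmxA.
Qed.

Lemma dot_trmx_mulr {R : realType} {m n} (A : 'M[R]_(m, n)) u v :
  dot u (A^T *m v) = dot (A *m u) v.
Proof. by rewrite dot_mulmxr trmxK. Qed.

Lemma enorm_ge0 {R : realType} {n} (v : 'cV[R]_n) : 0 <= enorm v.
Proof. exact: sqrtr_ge0. Qed.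
#[local] Hint Extern 0 (is_true (0 <= enorm _)) => exact: enorm_ge0 : core.

Lemma sqr_enorm {R : realType} {n} (v : 'cV[R]_n) : enorm v ^+ 2 = dot v v.
Proof.
rewrite sqr_sqrtr; first by apply: eq_bigr => i _; rewrite expr2.
by apply: sumr_ge0 => i _; apply: sqr_ge0.
Qed.

Lemma coord_le_enorm {R : realType} {n} (v : 'cV[R]_n) i : `|v i 0| <= enorm v.
Proof.
rewrite -[`|_|]sqrtr_sqr ler_wsqrtr// (bigD1 i)//=.
by rewrite lerDl sumr_ge0// => j _; apply: sqr_ge0.
Qed.

Lemma enorm_eq0 {R : realType} {n} (v : 'cV[R]_n) : enorm v = 0 -> v = 0.
Proof.
move=> v0; apply/colP => i; rewrite mxE; apply/eqP.
by rewrite -normr_le0 -v0 coord_le_enorm.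
Qed.

Lemma enorm0 {R : realType} {n} : enorm (0 : 'cV[R]_n) = 0.
Proof.
by rewrite /enorm big1 ?sqrtr0// => i _; rewrite mxE expr0n.
Qed.

Lemma enormZ {R : realType} {n} (a : R) (v : 'cV[R]_n) :
  enorm (a *: v) = `|a| * enorm v.
Proof.
apply/eqP; rewrite -(@eqrXn2 _ 2)// ?mulr_ge0//.
by rewrite exprMn !sqr_enorm dotZl dotZr real_normK ?num_real// expr2 mulrA.
Qed.

Lemma enormN {R : realType} {n} (v : 'cV[R]_n) : enorm (- v) = enorm v.
Proof. by rewrite -scaleN1r enormZ normrN1 mul1r. Qed.

Lemma enormBC {R : realType} {n} (u v : 'cV[R]_n) : enorm (u - v) = enorm (v - u).
Proof. by rewrite -enormN opprB. Qed.

(** Cauchy-Schwarz, by expanding the nonnegative square of [enorm (enorm v *: u - enorm u *: v)] and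
    dividing by [enorm u * enorm v], which is why zero norms are split off. *)
Lemma dot_le {R : realType} {n} (u v : 'cV[R]_n) : dot u v <= enorm u * enorm v.
Proof.
have [u0|u0] := eqVneq (enorm u) 0.
  by rewrite u0 mul0r (enorm_eq0 _ u0) dot0l.
have [v0|v0] := eqVneq (enorm v) 0.
  by rewrite v0 mulr0 (enorm_eq0 _ v0) dotC dot0l.
have uv : 0 < enorm u * enorm v by rewrite mulr_gt0// lt0r ?u0 ?v0/=.
have := sqr_ge0 (enorm (enorm v *: u - enorm u *: v)).
rewrite sqr_enorm !(dotDl, dotDr, dotNl, dotNr, dotZl, dotZr) -!sqr_enorm.
rewrite (dotC v u) => H.
rewrite -(ler_pM2l uv); nra.
Qed.

Lemma enormD {R : realType} {n} (u v : 'cV[R]_n) :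
  enorm (u + v) <= enorm u + enorm v.
Proof.
rewrite -(@ler_pXn2r _ 2)// ?nnegrE ?addr_ge0//.
rewrite sqr_enorm !(dotDl, dotDr) (dotC v u) -!sqr_enorm.
by have := dot_le u v; nra.
Qed.

Lemma enormB {R : realType} {n} (u v : 'cV[R]_n) :
  enorm (u - v) <= enorm u + enorm v.
Proof. by rewrite -(enormN v) enormD. Qed.

Lemma enorm_le_sum {R : realType} {n} (v : 'cV[R]_n) :
  enorm v <= \sum_(i < n) `|v i 0|.
Proof.
rewrite -(@ler_pXn2r _ 2)// ?nnegrE ?sumr_ge0// sqr_enorm expr2 mulr_suml.
apply: ler_sum => i _; rewrite -expr2 -real_normK ?num_real// expr2.
by rewrite ler_wpM2l// (bigD1 i)//= lerDl sumr_ge0.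
Qed.

Lemma normr_le_enorm {R : realType} {n} (v : 'cV[R]_n) : `|v| <= enorm v.
Proof.
rewrite /Num.norm/= mx_normrE; apply: bigmax_le => // -[i j] _.
by rewrite (ord1 j) coord_le_enorm.
Qed.

(** * Operator norm *)

Lemma has_sup_opnorm {R : realType} {m n} (A : 'M[R]_(m, n)) :
  has_sup [set enorm (A *m v) | v in [set v : 'cV[R]_n | enorm v <= 1]].
Proof.
split; first by exists (enorm (A *m 0)), 0 => //=; rewrite enorm0.
exists (\sum_(i < m) \sum_(j < n) `|A i j|) => _ [v /= v1 <-].
apply: (le_trans (enorm_le_sum _)); apply: ler_sum => i _.
rewrite mxE (le_trans (ler_norm_sum _ _ _))//; apply: ler_sum => j _.
by rewrite normrM ler_piMr// (le_trans (coord_le_enorm _ _)).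
Qed.

Lemma opnorm_ge0 {R : realType} {m n} (A : 'M[R]_(m, n)) : 0 <= opnorm A.
Proof.
apply: (sup_upper_bound (has_sup_opnorm A)).
by exists 0; rewrite /= ?mulmx0 enorm0.
Qed.
#[local] Hint Extern 0 (is_true (0 <= opnorm _)) => exact: opnorm_ge0 : core.

Lemma enorm_mulmx {R : realType} {m n} (A : 'M[R]_(m, n)) v :
  enorm (A *m v) <= opnorm A * enorm v.
Proof.
have [v0|v0] := eqVneq (enorm v) 0.
  by rewrite (enorm_eq0 _ v0) mulmx0 !enorm0 mulr0.
have vp : 0 < enorm v by rewrite lt0r v0/=.
rewrite -ler_pdivrMr//; apply: (sup_upper_bound (has_sup_opnorm A)).
exists ((enorm v)^-1 *: v) => /=.
  by rewrite enormZ ger0_norm ?invr_ge0// mulVf.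
by rewrite -scalemxAr enormZ ger0_norm ?invr_ge0// mulrC.
Qed.

(** Writing the square of [enorm (A^T *m v)] as the product of [v] with [A *m (A^T *m v)] lets the
    norm of [A] itself serve for its transpose. *)
Lemma enorm_mul_trmx {R : realType} {m n} (A : 'M[R]_(m, n)) v :
  enorm (A^T *m v) <= opnorm A * enorm v.
Proof.
have [v0|v0] := eqVneq (enorm (A^T *m v)) 0; first by rewrite v0 mulr_ge0.
have vp : 0 < enorm (A^T *m v) by rewrite lt0r v0/=.
rewrite -(ler_pM2r vp) -expr2 sqr_enorm -dot_mulmxr.
apply: (le_trans (dot_le _ _)); rewrite mulrAC mulrC ler_wpM2r//.
exact: enorm_mulmx.
Qed.

Lemma entry_le_opnorm {R : realType} {m n} (A : 'M[R]_(m, n)) i j :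
  `|A i j| <= opnorm A.
Proof.
have -> : A i j = (A *m delta_mx j 0 : 'cV_m) i 0.
  by rewrite -colE mxE.
apply: (le_trans (coord_le_enorm _ _)); apply: (le_trans (enorm_mulmx _ _)).
rewrite ler_piMr// (le_trans (enorm_le_sum _))// (bigD1 j)//= big1.
  by rewrite mxE !eqxx/= normr1 addr0.
by move=> k kj; rewrite mxE (negbTE kj) normr0.
Qed.

(** * Mean value theorem along a direction and first-order expansion *)

Lemma is_derive_line {R : realType} {V : normedModType R} (f : V -> R)
    (a e : V) (t : R) :
  derivable f (a + t *: e) e ->
  is_derive t 1 (fun s : R => f (a + s *: e)) ('D_e f (a + t *: e)).
Proof.
have E : (fun h => h^-1 *: (((fun s : R => f (a + s *: e)) \o shift t) (h *: 1)
             - f (a + t *: e))) =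
         (fun h : R => h^-1 *: ((f \o shift (a + t *: e)) (h *: e) - f (a + t *: e))).
  apply/funext => h /=; congr (_ *: (f _ - _)).
  by rewrite /shift/= scalerDl [h *: 1]mulr1 addrCA addrA [h *: e + _]addrC.
by move=> fe; split; rewrite /derivable /derive E.
Qed.

(** The one-variable mean value theorem is applied to [f (a + s *: e)] on the segment between 0 and
    [h], with the two signs of [h] treated separately. *)
Lemma MVT_direction {R : realType} {V : normedModType R} (f : V -> R) (a e : V) :
  (forall x, derivable f x e) -> forall h : R,
  exists2 c : R, `|c| <= `|h| & f (a + h *: e) - f a = h * 'D_e f (a + c *: e).
Proof.
move=> fe h; pose g := fun s : R => f (a + s *: e).
have dg (t : R) : is_derive t 1 g ('D_e f (a + t *: e)) by apply: is_derive_line.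
have cg (A : set R) : {within A, continuous g}.
  apply: continuous_subspaceT => t.
  by apply/differentiable_continuous/derivable1_diffP; case: (dg t).
have g0 : g 0 = f a by rewrite /g scale0r addr0.
rewrite -g0 -/(g h); have [h0|h0] := leP 0 h.
  have [c /[!in_itv]/= /andP[c0 ch] E] :=
    MVT_segment h0 (fun t _ => dg t) (cg _).
  by exists c; rewrite ?ger0_norm// E subr0 mulrC.
have [c /[!in_itv]/= /andP[c0 ch] E] :=
  MVT_segment (ltW h0) (fun t _ => dg t) (cg _).
exists c; first by rewrite !ler0_norm ?lerN2// ltW.
by rewrite -opprB E sub0r mulrN opprK mulrC.
Qed.

(* The increment of [f] is telescoped over the coordinates, changed one at a
   time, so that only partial derivatives are needed. *)
Lemma partial_taylor1 {R : realType} {n} (f : 'cV[R]_n -> R) (x y : 'cV[R]_n) (b : R) :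
  (forall j z, derivable f z (ebasis R j)) ->
  (forall j z, enorm (z - x) <= enorm (y - x) ->
     `|pderiv f j z - pderiv f j x| <= b) ->
  `|f y - f x - \sum_(j < n) pderiv f j x * (y - x) j 0|
    <= (n%:R * b) * enorm (y - x).
Proof.
move=> df Hb.
(* [q k] has the first [k] coordinates of [y] and the remaining ones of [x]. *)
pose q (k : nat) : 'cV[R]_n := \col_i (if (i < k)%N then y i 0 else x i 0).
have q0 : q 0%N = x by apply/colP => i; rewrite mxE.
have qn : q n = y by apply/colP => i; rewrite mxE ltn_ord.
have qS (j : 'I_n) : q j.+1 = q j + (y - x) j 0 *: ebasis R j.
  apply/colP => i; rewrite !mxE eqxx andbT ltnS leq_eqVlt.
  have [->|ij] := eqVneq i j; first by rewrite eqxx ltnn /= mulr1; ring.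
  by rewrite val_eqE (negbTE ij) mulr0 addr0.
have -> : f y - f x = \sum_(j < n) (f (q j.+1) - f (q j)).
  by rewrite -(big_mkord xpredT (fun j => f (q j.+1) - f (q j))) telescope_sumr//
     q0 qn.
rewrite -sumrB (le_trans (ler_norm_sum _ _ _))//.
have -> : n%:R * b * enorm (y - x) = \sum_(j < n) (b * enorm (y - x)).
  by rewrite sumr_const card_ord -mulrA mulr_natl.
apply: ler_sum => j _; rewrite qS.
have [c ch ->] := MVT_direction f (q j) (ebasis R j) (df j) ((y - x) j 0).
rewrite mulrC -mulrBl normrM ler_pM ?coord_le_enorm//; apply: Hb.
(* The intermediate point differs from [x] by at most [y - x] in every coordinate, so it is no
   further from [x] than [y] is. *)
rewrite ler_wsqrtr//; apply: ler_sum => i _.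
rewrite -real_normK ?num_real// -[leRHS]real_normK ?num_real//.
rewrite lerXn2r ?nnegrE// !mxE eqxx andbT.
have [ij|ij] := eqVneq i j; first by
  rewrite ij ltnn mulr1 addrAC subrr add0r; move: ch; rewrite !mxE.
rewrite mulr0 addr0; case: ifP => // _; by rewrite subrr normr0.
Qed.

(** * Complements of the kernel and the length of a step *)

Lemma rank_inverses {F : fieldType} {m n} (J : 'M[F]_(m, n)) :
  exists (G : 'M[F]_(\rank J, m)), exists (B : 'M[F]_(n, \rank J)), G *m J *m B = 1%:M.
Proof.
(* In the full-rank factorisation of [J] the column factor has a left inverse and the row factor a
   right inverse. The columns of [B] then span a complement of the kernel. *)
exists (pinvmx (col_base J)), (pinvmx (row_base J)).
rewrite -[X in _ *m X *m _](mulmx_base J) mulmxA mulVpmx ?col_base_full//.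
by rewrite mul1mx mulmxVp// row_base_free.
Qed.

(** Injectivity gives [J *m B] the same rank as [J], hence the same column space, so [J] factors as
    [J *m B *m D^T]; the coefficients are [D^T *m d]. *)
Lemma complement_of_injective {F : fieldType} {m n r} (J : 'M[F]_(m, n))
    (B : 'M[F]_(n, r)) :
  \rank J = r -> (forall a : 'cV_r, J *m (B *m a) = 0 -> a = 0) ->
  forall d : 'cV_n, exists a : 'cV_r, J *m (d - B *m a) = 0.
Proof.
move=> rJ inj d; pose X := (J *m B)^T.
have rX : \rank X = \rank J.
  rewrite rJ; apply/eqP; apply: inj_row_free => v; rewrite /X => vX.
  apply: trmx_inj; rewrite trmx0; apply: inj.
  by apply: trmx_inj; rewrite mulmxA trmx_mul trmxK vX trmx0.
have : (J^T <= X)%MS.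
  have XJ : (X <= J^T)%MS by rewrite /X trmx_mul submxMl.
  by rewrite -(mxrank_leqif_sup XJ) mxrank_tr rX.
case/submxP => D JD; exists (D^T *m d).
have JB : J = J *m B *m D^T by apply: trmx_inj; rewrite trmx_mul trmxK -JD.
by rewrite mulmxBr {1}JB !mulmxA subrr.
Qed.

(* A complement of [ker J0] remains a uniform complement of [ker J] for [J]
   close to [J0] because the two ranks agree. *)
Lemma uniform_complement {R : realType} {m n} (J0 : 'M[R]_(m, n)) :
  exists2 s : R, 0 < s & forall J, \rank J = \rank J0 -> opnorm (J - J0) <= s ->
    forall d : 'cV_n, exists2 w, J *m (d - w) = 0 & s * enorm w <= enorm (J *m w).
Proof.
have [G [B GB]] := rank_inverses J0.
(* On the range of [B], [J0] is bounded below by [1 / c]. A perturbation of size [1 / (2 * c)] costs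
   half of this; the added 1 keeps [c] positive. *)
pose c := opnorm B * opnorm G + 1.
have c0 : 0 < c by rewrite ltr_wpDl// mulr_ge0.
exists (2 * c)^-1; first by rewrite invr_gt0 mulr_gt0.
move=> J rJ JJ0.
have lb a : (2 * c)^-1 * enorm (B *m a) <= enorm (J *m (B *m a)).
  have Ba : enorm (B *m a) <= c * enorm (J0 *m (B *m a)).
    have aE : a = G *m (J0 *m (B *m a)) by rewrite !mulmxA GB mul1mx.
    rewrite {1}aE (le_trans (enorm_mulmx _ _))//.
    rewrite (@le_trans _ _ (opnorm B * (opnorm G * enorm (J0 *m (B *m a)))))//.
      by rewrite ler_wpM2l// enorm_mulmx.
    by rewrite mulrA ler_wpM2r// /c lerDl.
  have J0J : enorm (J0 *m (B *m a)) <=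
      enorm (J *m (B *m a)) + (2 * c)^-1 * enorm (B *m a).
    rewrite -{1}[J0](subKr J) mulmxBl (le_trans (enormB _ _))// lerD2l.
    by rewrite (le_trans (enorm_mulmx _ _))// ler_wpM2r.
  have := le_trans Ba (ler_wpM2l (ltW c0) J0J).
  rewrite mulrDr mulrA invfM (mulrCA c) mulfV ?gt_eqF// mulr1 => H.
  rewrite mulrAC -ler_pdivlMr ?invr_gt0// invrK mulrC; lra.
have inj (a : 'cV_(\rank J0)) : J *m (B *m a) = 0 -> a = 0.
  move=> JBa; have := lb a; rewrite JBa enorm0.
  rewrite pmulr_rle0 ?invr_gt0 ?mulr_gt0// => Ba.
  have Ba0 : B *m a = 0 by apply/enorm_eq0/eqP; rewrite eq_le Ba enorm_ge0.
  by rewrite -(mul1mx a) -GB -!mulmxA Ba0 !mulmx0.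
move=> d; have [a Ja] := complement_of_injective _ _ rJ inj d.
by exists (B *m a).
Qed.

(* Testing the normal equation against [ker J] shows that the [ker J] component
   of [d] is controlled by [w]; testing it against [d] controls [w]. *)
Lemma lmmss_step_bound {R : realType} {m n p} (J : 'M[R]_(m, n)) (L : 'M[R]_(p, n))
    (f : 'cV[R]_m) (d w : 'cV[R]_n) (lam gamma s : R) :
  0 < lam -> 0 < gamma -> 0 < s ->
  (forall v, gamma * enorm v ^+ 2 <= enorm (J *m v) ^+ 2 + enorm (L *m v) ^+ 2) ->
  (J^T *m J + lam *: (L^T *m L)) *m d = - (J^T *m f) ->
  J *m (d - w) = 0 -> s * enorm w <= enorm (J *m w) ->
  enorm d <= ((1 + opnorm L / Num.sqrt gamma) / s ^+ 2) * enorm (J^T *m f).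
Proof.
move=> lam0 gamma0 s0 A1 eqd Jk0 sw; set g := J^T *m f.
have dE : d = w + (d - w) by rewrite addrC subrK.
move: (d - w) Jk0 dE => k Jk0 dE.
have test v : dot (J *m v) (J *m d) + lam * dot (L *m v) (L *m d) = - dot (J *m v) f.
  have := congr1 (dot v) eqd.
  by rewrite mulmxDl -scalemxAl dotDr dotZr dotNr -!mulmxA !dot_trmx_mulr.
have JdE : J *m d = J *m w by rewrite dE mulmxDr Jk0 addr0.
(* Tested against [k], the equation keeps only its [lam] term. Since [lam] is positive, [L *m k] is
   orthogonal to [L *m d], whatever the size of [lam]. *)
have Lk : enorm (L *m k) <= opnorm L * enorm w.
  have := test k; rewrite Jk0 !dot0l add0r oppr0 => /eqP.
  rewrite mulf_eq0 gt_eqF//= dE mulmxDr dotDr -sqr_enorm => /eqP LkE.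
  have [Lk0|Lk0] := eqVneq (enorm (L *m k)) 0; first by rewrite Lk0 mulr_ge0.
  have Lkp : 0 < enorm (L *m k) by rewrite lt0r Lk0/=.
  apply: le_trans (enorm_mulmx L w).
  have := dot_le (L *m k) (- (L *m w)); rewrite dotNr enormN => H.
  rewrite -(ler_pM2l Lkp); lra.
(* With [J *m k = 0], (A1) bounds [k] by [L *m k] alone. *)
have kw : enorm k <= opnorm L / Num.sqrt gamma * enorm w.
  have sg : 0 < Num.sqrt gamma by rewrite sqrtr_gt0.
  rewrite mulrAC ler_pdivlMr// -(@ler_pXn2r _ 2)// ?nnegrE ?mulr_ge0 ?(ltW sg)//.
  rewrite exprMn (sqr_sqrtr (ltW gamma0)) mulrC (le_trans (A1 k))//.
  by rewrite Jk0 enorm0 expr0n add0r lerXn2r ?nnegrE ?mulr_ge0.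
(* Testing against [d] and dropping the nonnegative [lam] term bounds the square of [enorm (J *m w)]
   by the product of [- g] with [d]; as [g] lies in the range of [J^T], only [w] contributes
   there. *)
have ws : enorm w <= enorm g / s ^+ 2.
  have [w0|w0] := eqVneq (enorm w) 0.
    by rewrite w0 divr_ge0// exprn_ge0// ltW.
  have wp : 0 < enorm w by rewrite lt0r w0/=.
  rewrite ler_pdivlMr ?exprn_gt0// -(ler_pM2l wp).
  have := test d; rewrite JdE -sqr_enorm -sqr_enorm -dotNr dotC dot_mulmxr.
  rewrite mulmxN -/g => E.
  have := dot_le (- g) w; rewrite enormN => H.
  have := @lerXn2r _ 2 (s * enorm w) (enorm (J *m w)).
  rewrite !nnegrE mulr_ge0 ?(ltW s0)// => /(_ erefl (enorm_ge0 _) sw).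
  have : 0 <= lam * enorm (L *m d) ^+ 2 by rewrite mulr_ge0 ?sqr_ge0// ltW.
  rewrite exprMn; nra.
rewrite {1}dE (le_trans (enormD _ _))//.
apply: (@le_trans _ _ ((1 + opnorm L / Num.sqrt gamma) * enorm w)).
  by rewrite mulrDl mul1r lerD2l.
rewrite -mulrA [_^-1 * _]mulrC ler_wpM2l//.
by rewrite addr_ge0// divr_ge0// sqrtr_ge0.
Qed.

(** * Balls and distance to a set *)

Lemma in_cball {R : realType} {n} (c x : 'cV[R]_n) (r : R) :
  (x \in cball c r) = (enorm (x - c) <= r).
Proof. by apply/idP/idP => [/set_mem|H] //; apply: mem_set. Qed.

Lemma distS_lbound {R : realType} {n} (S : set 'cV[R]_n) x :
  has_lbound [set enorm (x - z) | z in S].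
Proof. by exists 0 => _ [z _ <-]. Qed.

Lemma distS_le {R : realType} {n} (S : set 'cV[R]_n) x z :
  S z -> distS S x <= enorm (x - z).
Proof. by move=> Sz; apply: ge_inf; [exact: distS_lbound|exists z]. Qed.

Lemma distS_ge0 {R : realType} {n} (S : set 'cV[R]_n) x : 0 <= distS S x.
Proof.
have [->|/set0P[z Sz]] := eqVneq S set0; first by rewrite /distS image_set0 inf0.
by apply: lb_le_inf; [exists (enorm (x - z)), z|move=> _ [t _ <-]].
Qed.
#[local] Hint Extern 0 (is_true (0 <= distS _ _)) => exact: distS_ge0 : core.

Lemma distS_lt {R : realType} {n} (S : set 'cV[R]_n) x e :
  S !=set0 -> distS S x < e -> exists2 z, S z & enorm (x - z) < e.
Proof.
move=> [z0 Sz0]; rewrite -subr_gt0 => De.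
have [|_ [z Sz <-]] := inf_adherent (E := [set enorm (x - z) | z in S]) De.
  by split; [exists (enorm (x - z0)), z0|exact: distS_lbound].
by rewrite addrCA subrr addr0 => ze; exists z.
Qed.

(** * Local bounds on [F], its Jacobian and the gradient; splitting of the new gradient *)

Lemma opnormD {R : realType} {m n} (A B : 'M[R]_(m, n)) :
  opnorm (A + B) <= opnorm A + opnorm B.
Proof.
apply: ge_sup; first by case: (has_sup_opnorm (A + B)).
move=> _ [v /= v1 <-]; rewrite mulmxDl (le_trans (enormD _ _))// lerD//.
  by rewrite (le_trans (enorm_mulmx _ _))// ler_piMr.
by rewrite (le_trans (enorm_mulmx _ _))// ler_piMr.
Qed.

Lemma jac_taylor1 {R : realType} {n m} (F : 'cV[R]_n -> 'cV[R]_m) (x y : 'cV[R]_n)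
    (b : R) :
  C2 F ->
  (forall z, enorm (z - x) <= enorm (y - x) -> opnorm (jacF F z - jacF F x) <= b) ->
  enorm (F y - F x - jacF F x *m (y - x)) <= m%:R * (n%:R * b) * enorm (y - x).
Proof.
move=> C2F Hb; rewrite (le_trans (enorm_le_sum _))//.
have -> : m%:R * (n%:R * b) * enorm (y - x) =
    \sum_(i < m) (n%:R * b) * enorm (y - x).
  by rewrite sumr_const card_ord -mulrA mulr_natl.
apply: ler_sum => i _; have [_ C2i] := C2F i.
have -> : (F y - F x - jacF F x *m (y - x)) i 0 = compF F i y - compF F i x -
    \sum_(j < n) pderiv (compF F i) j x * (y - x) j 0.
  by rewrite !mxE; congr (_ - _); apply: eq_bigr => j _; rewrite !mxE.
apply: partial_taylor1 => [j z|j z zx]; first by have [] := C2i j.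
rewrite (le_trans _ (Hb z zx))// (le_trans _ (entry_le_opnorm _ i j))//.
by rewrite !mxE.
Qed.

(** The condition [enorm (x - xs) + enorm (y - x) <= delta] keeps in the ball all points no further
    from [x] than [y], so (A2) applies to them. As [delta < 1], quadratic errors are absorbed in
    linear ones, and one [M] serves all bounds. *)
Lemma C2_local_bounds {R : realType} {n m} (F : 'cV[R]_n -> 'cV[R]_m)
    (xs : 'cV[R]_n) (delta L0 : R) :
  C2 F -> 0 < delta < 1 -> 0 < L0 ->
  (forall x y, enorm (x - xs) <= delta -> enorm (y - xs) <= delta ->
     opnorm (jacF F x - jacF F y) <= L0 * enorm (x - y)) ->
  exists2 M : R, 0 <= M &
    (forall x, enorm (x - xs) <= delta -> opnorm (jacF F x) <= M) /\
    (forall x y, enorm (x - xs) + enorm (y - x) <= delta ->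
       [/\ enorm (F y - F x - jacF F x *m (y - x)) <= M * enorm (y - x) ^+ 2,
           enorm (F y - F x) <= M * enorm (y - x) &
           enorm ((jacF F y)^T *m F y - (jacF F x)^T *m F x) <= M * enorm (y - x)]).
Proof.
move=> C2F /andP[d0 d1] L00 A2.
pose c := m%:R * (n%:R * L0).
have c0 : 0 <= c by rewrite !mulr_ge0// ltW.
pose M1 := opnorm (jacF F xs) + L0; pose M2 := M1 + c.
pose M3 := enorm (F xs) + M2; pose M4 := M1 * M2 + L0 * M3.
have M10 : 0 <= M1 by rewrite addr_ge0// ltW.
have M20 : 0 <= M2 by rewrite addr_ge0.
have M30 : 0 <= M3 by rewrite addr_ge0.
have M40 : 0 <= M4 by rewrite addr_ge0// mulr_ge0// ltW.
have xsd : enorm (xs - xs) <= delta by rewrite subrr enorm0 ltW.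
have J1 x : enorm (x - xs) <= delta -> opnorm (jacF F x) <= M1.
  move=> xd; rewrite -[jacF F x](subrK (jacF F xs)) (le_trans (opnormD _ _))//.
  rewrite addrC lerD2l (le_trans (A2 _ _ xd xsd))// ler_piMr ?(ltW L00)//.
  by rewrite (le_trans xd)// ltW.
have T x y : enorm (x - xs) + enorm (y - x) <= delta ->
    enorm (F y - F x - jacF F x *m (y - x)) <= c * enorm (y - x) ^+ 2.
  move=> xyd; have xd : enorm (x - xs) <= delta.
    by rewrite (le_trans _ xyd)// lerDl.
  have -> : c * enorm (y - x) ^+ 2 = m%:R * (n%:R * (L0 * enorm (y - x))) * enorm (y - x).
    by rewrite /c; ring.
  apply: jac_taylor1 => // z zx; rewrite (le_trans (A2 _ _ _ xd))//;
    last by rewrite ler_wpM2l// ltW.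
  rewrite -(subrK x z) -addrA (le_trans (enormD _ _))//.
  by rewrite (le_trans _ xyd)// [leRHS]addrC lerD2r.
have T2 x y : enorm (x - xs) + enorm (y - x) <= delta ->
    enorm (F y - F x) <= M2 * enorm (y - x).
  move=> xyd; have xd : enorm (x - xs) <= delta.
    by rewrite (le_trans _ xyd)// lerDl.
  have yx1 : enorm (y - x) <= 1.
    by rewrite (le_trans _ (ltW d1))// (le_trans _ xyd)// lerDr.
  rewrite -[F y - F x](subrK (jacF F x *m (y - x))) (le_trans (enormD _ _))//.
  rewrite /M2 mulrDl addrC lerD//.
    by rewrite (le_trans (enorm_mulmx _ _))// ler_wpM2r// J1.
  by rewrite (le_trans (T _ _ xyd))// ler_wpM2l// expr2 ler_piMr.
have F3 x : enorm (x - xs) <= delta -> enorm (F x) <= M3.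
  move=> xd; rewrite -[F x](subrK (F xs)) (le_trans (enormD _ _))//.
  have xsx : enorm (xs - xs) + enorm (x - xs) <= delta by rewrite subrr enorm0 add0r.
  rewrite addrC lerD2l (le_trans (T2 _ _ xsx))//.
  by rewrite ler_piMr// (le_trans xd)// ltW.
exists (M1 + M2 + M4); first by lra.
split=> [x xd|x y xyd]; first by rewrite (le_trans (J1 _ xd))//; lra.
have xd : enorm (x - xs) <= delta by rewrite (le_trans _ xyd)// lerDl.
have yd : enorm (y - xs) <= delta.
  rewrite -(subrK x y) -addrA (le_trans (enormD _ _))//.
  by rewrite (le_trans _ xyd)// [leLHS]addrC.
split.
- rewrite (le_trans (T _ _ xyd))// ler_wpM2r ?sqr_ge0//.
  by have cM2 : c <= M2 by [rewrite lerDr]; lra.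
- by rewrite (le_trans (T2 _ _ xyd))// ler_wpM2r//; lra.
have -> : (jacF F y)^T *m F y - (jacF F x)^T *m F x =
    (jacF F y)^T *m (F y - F x) + (jacF F y - jacF F x)^T *m F x.
  by rewrite [(_ - _)^T]linearB/= mulmxBl mulmxBr addrA subrK.
rewrite (le_trans (enormD _ _))// (@le_trans _ _ (M4 * enorm (y - x)))//; last first.
  by rewrite ler_wpM2r//; lra.
rewrite /M4 mulrDl lerD// (le_trans (enorm_mul_trmx _ _))//.
  by rewrite -mulrA ler_pM// ?J1// T2.
by rewrite mulrAC ler_pM// ?A2// F3.
Qed.

(* The gradient [J'^T F'] at the new point splits into the regularisation residual,
   the linearisation error of [F], and the variation of [J] tested against [F z]
   and against [F' - F z]. *)
Lemma lmmss_gradient_split {R : comNzRingType} {m n p} (J J' Jz : 'M[R]_(m, n))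
    (L : 'M[R]_(p, n)) (f f' fz : 'cV[R]_m) (d : 'cV[R]_n) (lam : R) :
  (J^T *m J + lam *: (L^T *m L)) *m d = - (J^T *m f) ->
  J'^T *m f' = - (lam *: (L^T *m (L *m d))) + J^T *m (f' - f - J *m d)
    + ((J' - Jz)^T *m fz - (J - Jz)^T *m fz) + (J' - J)^T *m (f' - fz).
Proof.
rewrite mulmxDl -scalemxAl -!mulmxA => /eqP.
rewrite -subr_eq0 opprK => /eqP eqd; apply/subr0_eq; rewrite -[RHS]eqd.
rewrite ![(_ - _)^T]linearB/= !mulmxBr !mulmxBl.
by apply/colP => i; move: (J^T) (J'^T) (Jz^T) => A A' Az; rewrite !mxE; ring.
Qed.

(** * Real powers and the estimate for one step *)

Lemma ler_powR2r {R : realType} (a b s : R) :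
  0 <= s -> 0 <= a -> a <= b -> a `^ s <= b `^ s.
Proof.
by move=> s0 a0 ab; apply: ge0_ler_powR; rewrite ?nnegrE// (le_trans a0).
Qed.

Lemma powR_scale_le {R : realType} (k D a s : R) :
  0 <= s -> 0 <= k -> 0 <= D -> 0 <= a -> a <= k * D -> a `^ s <= k `^ s * D `^ s.
Proof. by move=> s0 k0 D0 a0 aD; rewrite -powRM// ler_powR2r. Qed.

Lemma sqr_le_powR1D {R : realType} (D r : R) :
  0 <= D <= 1 -> 0 < r <= 1 -> D ^+ 2 <= D `^ (1 + r).
Proof.
move=> /andP[D0 D1] /andP[r0 r1].
have [->|Dn0] := eqVneq D 0; first by rewrite expr0n powR_ge0.
have Dp : 0 < D <= 1 by rewrite lt0r Dn0 D0 D1.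
rewrite -powR_mulrn// ger_powR//; lra.
Qed.

(** The gradient vanishes on [Xstar], so its Lipschitz bound is used against points [z] of [Xstar]
    that nearly realise the infimum. The strict inequality leaves room for them to be admissible. *)
Lemma gradient_le_distS {R : realType} {n m} (F : 'cV[R]_n -> 'cV[R]_m)
    (xs x : 'cV[R]_n) (delta M : R) :
  0 <= M -> Xstar F !=set0 ->
  (forall z, enorm (z - xs) + enorm (x - z) <= delta ->
     enorm ((jacF F x)^T *m F x - (jacF F z)^T *m F z) <= M * enorm (x - z)) ->
  enorm (x - xs) + 2 * distS (Xstar F) x < delta ->
  enorm ((jacF F x)^T *m F x) <= M * distS (Xstar F) x.
Proof.
move=> M0 S0 gL; set D := distS _ _ => xD.
apply/ler_addgt0Pr => e e0.
pose h := (delta - enorm (x - xs) - 2 * D) / 2.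
pose e' := Num.min h (e / (M + 1)).
have e'0 : 0 < e' by rewrite lt_min !divr_gt0//; lra.
have Me' : M * e' <= e.
  have : e' * (M + 1) <= e by rewrite -ler_pdivlMr ?ge_min ?lexx ?orbT//; lra.
  lra.
have e'h : e' <= h by rewrite ge_min lexx.
have [z Sz xz] : exists2 z, Xstar F z & enorm (x - z) < D + e'.
  by apply: distS_lt => //; rewrite ltrDl.
have zxs : enorm (z - xs) <= enorm (x - z) + enorm (x - xs).
  by rewrite (enormBC x z) -[z - xs](subrKA x) enormD.
have := gL z; rewrite (Sz : (jacF F z)^T *m F z = 0) subr0 => /(_ _)/le_trans; apply.
  by move: e'h; rewrite /h; lra.
by rewrite (le_trans (ler_wpM2l M0 (ltW xz)))// mulrDr lerD2l.
Qed.

Lemma lmmss_local_step {R : realType} {n m p : nat}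
    (F : 'cV[R]_n -> 'cV[R]_m) (L : 'M[R]_(p, n)) (xs : 'cV[R]_n)
    (delta L0 omega gamma C r : R) :
  C2 F -> Xstar F xs -> 0 < gamma ->
  (forall x, enorm (x - xs) <= delta -> forall v : 'cV[R]_n,
     gamma * enorm v ^+ 2 <= enorm (jacF F x *m v) ^+ 2 + enorm (L *m v) ^+ 2) ->
  0 < delta < 1 -> 0 < L0 ->
  (forall x y, enorm (x - xs) <= delta -> enorm (y - xs) <= delta ->
     opnorm (jacF F x - jacF F y) <= L0 * enorm (x - y)) ->
  0 < omega ->
  (forall x, enorm (x - xs) <= delta ->
     omega * distS (Xstar F) x <= enorm ((jacF F x)^T *m F x)) ->
  0 < r <= 1 -> 0 <= C ->
  (forall x z, enorm (x - xs) <= delta -> Xstar F z -> enorm (z - xs) <= delta ->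
     enorm ((jacF F x - jacF F z)^T *m F z) <= C * enorm (x - z) `^ (1 + r)) ->
  (forall x, enorm (x - xs) <= delta -> \rank (jacF F x) = \rank (jacF F xs)) ->
  exists rho c1 K : R, [/\ 0 < rho, 0 <= c1, 0 < K &
    forall x d : 'cV[R]_n, enorm (x - xs) <= rho ->
      let J := jacF F x in
      let lam := enorm (J^T *m F x) in
      (J^T *m J + lam *: (L^T *m L)) *m d = - (J^T *m F x) ->
      (lam = 0 -> d = 0) ->
      enorm d <= c1 * distS (Xstar F) x /\
      distS (Xstar F) (x + d) <= K * distS (Xstar F) x `^ (1 + r)].
Proof.
move=> C2F Sxs gamma0 A1 d01 L00 A2 om0 A3 r01 C0 A4 rk.
have [M M0 [MJ MT]] := C2_local_bounds _ _ _ _ C2F d01 L00 A2.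
have [s s0 compl] := uniform_complement (jacF F xs).
have /andP[d0 d1] := d01; have /andP[r0 r1] := r01.
set S := Xstar F in Sxs A3 A4 *.
have xsd : enorm (xs - xs) <= delta by rewrite subrr enorm0 ltW.
pose l := opnorm L.
have l0 : 0 <= l by exact: opnorm_ge0.
pose c1 := ((1 + l / Num.sqrt gamma) / s ^+ 2) * M.
have c2p : 0 <= (1 + l / Num.sqrt gamma) / s ^+ 2.
  by rewrite divr_ge0 ?sqr_ge0// addr_ge0// divr_ge0// sqrtr_ge0.
have c10 : 0 <= c1 by rewrite mulr_ge0.
(* The four summands bound, in order, the four terms of [lmmss_gradient_split]; the third comes from
   (A4) at [x + d] and at [x]. *)
pose K1 := M * l ^+ 2 * c1 + M ^+ 2 * c1 ^+ 2
  + C * ((2 + c1) `^ (1 + r) + 2 `^ (1 + r)) + L0 * c1 * M * (2 + c1).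
have K10 : 0 <= K1.
  by repeat (done || exact: sqr_ge0 || exact: powR_ge0 || exact: ltW ||
    apply: addr_ge0 || apply: mulr_ge0).
(* The first bound keeps [x], [x + d] and the nearby [z] inside the ball, with room for the
   Lipschitz bound from [z] to [x + d]; the second brings the Jacobian within [s] of the one at
   [xs]. *)
pose rho := Num.min (delta / (c1 + 8)) (s / L0).
have rho0 : 0 < rho by rewrite lt_min !divr_gt0//; lra.
have rho_delta : (c1 + 8) * rho <= delta.
  by rewrite mulrC -ler_pdivlMr ?ge_min ?lexx//; lra.
have rho_s : L0 * rho <= s by rewrite mulrC -ler_pdivlMr// ge_min lexx orbT.
have c1rho : 0 <= c1 * rho by rewrite mulr_ge0// ltW.
exists rho, c1, (K1 / omega + 1); split=> //; first by rewrite ltr_wpDl// divr_ge0// ltW.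
move=> x d xrho J lam eqd lam0.
have S0 : S !=set0 by exists xs.
set D := distS S x.
have D0 : 0 <= D by exact: distS_ge0.
have Drho : D <= rho by rewrite (le_trans (distS_le _ _ _ Sxs)).
have xd : enorm (x - xs) <= delta by lra.
have lamD : lam <= M * D.
  apply: (gradient_le_distS _ xs _ delta) => // [z xz|]; last by rewrite -/S -/D; lra.
  by have [] := MT z x xz.
have dD : enorm d <= c1 * D.
  (* For [lam = 0] the linear system may be singular, so the convention [d = 0] is what controls the
     step. *)
  have [l0'|lamn0] := eqVneq lam 0; first by rewrite (lam0 l0') enorm0 mulr_ge0.
  have lamp : 0 < lam by rewrite lt0r lamn0 /lam/=.
  have [|w Jdw sw] := compl J (rk _ xd) _ d.
    rewrite (le_trans (A2 _ _ xd xsd))// (le_trans _ rho_s)// ler_wpM2l// ltW//.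
  have := lmmss_step_bound J L (F x) d w lam gamma s lamp gamma0 s0 (A1 _ xd) eqd Jdw sw.
  by move=> /le_trans; apply; rewrite /c1 -[leRHS]mulrA ler_wpM2l.
split=> //.
(* The point [z] below is found within [2 * D] of [x], which needs [D] positive; for [D = 0] the
   step is zero. *)
have [Dz|Dn0] := eqVneq D 0.
  rewrite Dz powR0 ?mulr0; last by rewrite gt_eqF//; lra.
  have /enorm_eq0 -> : enorm d = 0.
    by apply/eqP; rewrite eq_le enorm_ge0 andbT (le_trans dD)// Dz mulr0.
  by rewrite addr0 -/D Dz.
have Dp : 0 < D by rewrite lt0r Dn0.
have [z Sz xz] : exists2 z, S z & enorm (x - z) < D + D.
  by apply: distS_lt => //; rewrite ltrDl.
have zxs : enorm (z - xs) <= enorm (x - z) + enorm (x - xs).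
  by rewrite (enormBC x z) -[z - xs](subrKA x) enormD.
have zd : enorm (z - xs) <= delta by lra.
have c1D : c1 * D <= c1 * rho by rewrite ler_wpM2l.
have xdz : enorm (x + d - z) <= (2 + c1) * D.
  by rewrite addrAC (le_trans (enormD _ _))//; lra.
have xdxs : enorm (x + d - xs) <= enorm (x - xs) + enorm d.
  by rewrite addrAC enormD.
have xdd : enorm (x + d - xs) <= delta by lra.
set P := D `^ (1 + r).
have D2P : D ^+ 2 <= P by apply: sqr_le_powR1D => //; lra.
have gb : enorm ((jacF F (x + d))^T *m F (x + d)) <= K1 * P.
  have [|T _ _] := MT x (x + d); first by rewrite addrAC subrr add0r; lra.
  have [|_ T2 _] := MT z (x + d); first by lra.
  rewrite (addrAC x d) subrr add0r in T.
  rewrite (lmmss_gradient_split _ _ (jacF F z) _ _ _ (F z) _ _ eqd).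
  rewrite /K1 !mulrDl; apply: (le_trans (enormD _ _)); apply: lerD.
    apply: (le_trans (enormD _ _)); apply: lerD.
      apply: (le_trans (enormD _ _)); apply: lerD.
        rewrite enormN enormZ ger0_norm ?/lam//.
        have LLd : enorm (L^T *m (L *m d)) <= l ^+ 2 * (c1 * D).
          rewrite (le_trans (enorm_mul_trmx _ _))// expr2 -mulrA ler_wpM2l//.
          by rewrite (le_trans (enorm_mulmx _ _))// ler_wpM2l.
        apply: le_trans (_ : M * D * (l ^+ 2 * (c1 * D)) <= _).
          by apply: ler_pM.
        have -> : M * D * (l ^+ 2 * (c1 * D)) = M * l ^+ 2 * c1 * D ^+ 2 by ring.
        by rewrite ler_wpM2l//; do 2![apply: mulr_ge0 => //]; apply: sqr_ge0.
      rewrite (le_trans (enorm_mul_trmx _ _))//.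
      have dsq : enorm d ^+ 2 <= (c1 * D) ^+ 2 by rewrite lerXn2r ?nnegrE ?(mulr_ge0 c10 D0).
      apply: le_trans (_ : M * (M * (c1 * D) ^+ 2) <= _).
        by apply: ler_pM => //; [exact: MJ|rewrite (le_trans T)// ler_wpM2l].
      have -> : M * (M * (c1 * D) ^+ 2) = M ^+ 2 * c1 ^+ 2 * D ^+ 2 by ring.
      by rewrite ler_wpM2l//; apply: mulr_ge0; apply: sqr_ge0.
    rewrite (le_trans (enormB _ _))// mulrDr mulrDl lerD//.
      rewrite (le_trans (A4 _ _ xdd Sz zd))// -mulrA ler_wpM2l// powR_scale_le//; lra.
    rewrite (le_trans (A4 _ _ xd Sz zd))// -mulrA ler_wpM2l// powR_scale_le//; lra.
  rewrite (le_trans (enorm_mul_trmx _ _))//.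
  have JJ : opnorm (jacF F (x + d) - J) <= L0 * (c1 * D).
    rewrite (le_trans (A2 _ _ xdd xd))// addrAC subrr add0r ler_wpM2l// ltW//.
  apply: le_trans (_ : L0 * (c1 * D) * (M * ((2 + c1) * D)) <= _).
    by apply: ler_pM => //; rewrite (le_trans T2)// ler_wpM2l.
  have -> : L0 * (c1 * D) * (M * ((2 + c1) * D)) = L0 * c1 * M * (2 + c1) * D ^+ 2.
    by ring.
  have L0c1 : 0 <= L0 * c1 by rewrite mulr_ge0// ltW.
  by rewrite ler_wpM2l//; do 2?[apply: mulr_ge0 => //]; apply: addr_ge0.
have P0 : 0 <= P by apply: powR_ge0.
rewrite mulrDl mul1r -[leLHS]addr0 lerD// mulrAC ler_pdivlMr// mulrC.
exact: le_trans (A3 _ xdd) gb.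
Qed.

(** * Convergence of the iteration *)

Lemma enorm_cvg0 {R : realType} {n} (x : nat -> 'cV[R]_n) (l : 'cV[R]_n) :
  x @ \oo --> l -> (fun k => enorm (l - x k)) @ \oo --> 0.
Proof.
move=> xl; have xl0 : (fun k => n%:R * `|l - x k|) @ \oo --> 0.
  rewrite -(mulr0 n%:R); apply: cvgMr.
  have := cvg_norm (cvgB (cvg_cst l) xl); rewrite subrr normr0; exact.
apply: (squeeze_cvgr _ (cvg_cst 0) xl0); near=> k; rewrite enorm_ge0/=.
rewrite (le_trans (enorm_le_sum _))// mulr_natl -[X in _ *+ X]card_ord -sumr_const.
apply: ler_sum => i _; rewrite [leRHS]/Num.norm/= mx_normrE.
exact: (le_bigmax _ (fun ij => `|(l - x k) ij.1 ij.2|) (i, 0)).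
Unshelve. all: end_near. Qed.

Lemma geometric_half_small {R : realType} (a e : R) :
  0 < e -> exists N, a * 2^-1 ^+ N < e.
Proof.
move=> e0; have z1 : `|2^-1 : R| < 1 by rewrite ger0_norm ?invr_ge0// invf_lt1// ltr1n.
have /cvgrPdist_lt/(_ _ e0)[N _ /(_ N (leqnn N))] := cvg_geometric a z1.
by rewrite /= sub0r normrN => /(le_lt_trans (ler_norm _)); exists N.
Qed.

(** Telescoping the geometric series bounds the tails, so the sequence is Cauchy, and the space is
    complete. *)
Lemma cvg_of_geometric_step {R : realType} {n} (x : nat -> 'cV[R]_n) (a : R) :
  (forall k, enorm (x k.+1 - x k) <= a * 2^-1 ^+ k) -> exists l : 'cV[R]_n, x @ \oo --> l.
Proof.
move=> xS; suff : cauchy (x @ \oo) by move/cauchy_cvg/cvg_ex.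
have tail k j : enorm (x (k + j)%N - x k) <= 2 * a * (2^-1 ^+ k - 2^-1 ^+ (k + j)).
  elim: j => [|j IH]; first by rewrite addn0 !subrr enorm0 mulr0.
  rewrite addnS -(subrKA (x (k + j)%N)) (le_trans (enormD _ _))//.
  rewrite (le_trans (lerD (xS _) IH))// exprS; lra.
have a0 : 0 <= a by have := xS 0%N; rewrite expr0 mulr1; apply: le_trans.
apply: cauchy_exP => e e0; have [N aN] := geometric_half_small (2 * a) e e0.
exists (x N); exists N => // k /= Nk; rewrite -ball_normE /ball_/=.
rewrite -normrN opprB (le_lt_trans (normr_le_enorm _))// (le_lt_trans _ aN)//.
have := tail N (k - N)%N; rewrite subnKC// => /le_trans; apply.
by rewrite ler_wpM2l ?mulr_ge0// gerBl exprn_ge0// invr_ge0.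
Qed.

Lemma superlinear_iteration {R : realType} {n} (S : set 'cV[R]_n) (xs : 'cV[R]_n)
    (T : 'cV[R]_n -> 'cV[R]_n -> Prop) (rho c1 K r : R) :
  S xs -> 0 < rho -> 0 <= c1 -> 0 < K -> 0 < r ->
  (forall x y, enorm (x - xs) <= rho -> T x y ->
     enorm (y - x) <= c1 * distS S x /\ distS S y <= K * distS S x `^ (1 + r)) ->
  exists2 eps : R, 0 < eps &
    forall x : nat -> 'cV[R]_n, (forall k, T (x k) (x k.+1)) ->
      enorm (x 0%N - xs) <= eps ->
      [/\ forall k, enorm (x k - xs) <= rho,
          (fun k => distS S (x k)) @ \oo --> 0 &
          exists l : 'cV[R]_n, x @ \oo --> l].
Proof.
move=> Sxs rho0 c10 K0 r0 HT.
pose eta := (2 * K) `^ (- r^-1).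
have eta0 : 0 < eta by rewrite powR_gt0// mulr_gt0.
have Keta : K * eta `^ r = 2^-1.
  rewrite -powRrM mulNr mulVf ?gt_eqF// powR_inv1 ?mulr_ge0 ?ltW//.
  by rewrite invfM mulrCA mulfV ?gt_eqF// mulr1.
(* With halving distances the steps sum to at most [2 * c1 * eps], so iterates started within [eps]
   stay within [rho]. *)
pose eps := Num.min eta (rho / (1 + 2 * c1)).
have c1p : 0 < 1 + 2 * c1 by lra.
have eps0 : 0 < eps by rewrite lt_min eta0 divr_gt0.
have eps_rho : eps + 2 * c1 * eps <= rho.
  have : eps * (1 + 2 * c1) <= rho by rewrite -ler_pdivlMr// ge_min lexx orbT.
  lra.
have eps_eta : eps <= eta by rewrite ge_min lexx.
have half D : 0 <= D -> D <= eps -> K * D `^ (1 + r) <= 2^-1 * D.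
  move=> D0 De; rewrite powRD; last by rewrite gt_eqF// addr_gt0.
  rewrite powRr1// mulrCA mulrC ler_wpM2r// -Keta ler_wpM2l ?(ltW K0)//.
  by rewrite ler_powR2r ?(ltW r0)// (le_trans De).
exists eps => // x Tx x0; pose q k : R := 2^-1 ^+ k.
have q01 k : 0 <= q k <= 1.
  by rewrite exprn_ge0 ?invr_ge0//= exprn_ile1 ?invr_ge0// invf_le1// ler1n.
have inv k : enorm (x k - xs) <= eps + 2 * c1 * eps * (1 - q k) /\
             distS S (x k) <= eps * q k.
  elim: k => [|k [IHx IHD]].
    rewrite /q expr0 subrr mulr0 addr0 mulr1; split=> //.
    exact: le_trans (distS_le _ _ _ Sxs) x0.
  have /andP[q0 q1] := q01 k.
  have ce : 0 <= c1 * eps by rewrite mulr_ge0// ltW.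
  have xrho : enorm (x k - xs) <= rho.
    by rewrite (le_trans IHx)// (le_trans _ eps_rho)// lerD2l; nra.
  have [step decr] := HT _ _ xrho (Tx k).
  have De : distS S (x k) <= eps by rewrite (le_trans IHD)// ler_piMr// ltW.
  have qS : q k.+1 = 2^-1 * q k by rewrite /q exprS.
  split.
    rewrite -(subrKA (x k)) (le_trans (enormD _ _))// (le_trans (lerD step IHx))//.
    have := ler_wpM2l c10 IHD; rewrite qS; lra.
  rewrite (le_trans decr)// (le_trans (half _ (distS_ge0 _ _) De))// qS; lra.
have xrho k : enorm (x k - xs) <= rho.
  have [IHx _] := inv k; have /andP[q0 q1] := q01 k.
  have ce : 0 <= c1 * eps by rewrite mulr_ge0// ltW.
  by rewrite (le_trans IHx)// (le_trans _ eps_rho)// lerD2l; nra.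
split=> //.
  have z1 : `|2^-1 : R| < 1 by rewrite ger0_norm ?invr_ge0// invf_lt1// ltr1n.
  apply: (squeeze_cvgr _ (cvg_cst 0) (cvg_geometric eps z1)); near=> k.
  by rewrite distS_ge0/=; have [] := inv k.
apply: (cvg_of_geometric_step x (c1 * eps)) => k.
have [step _] := HT _ _ (xrho k) (Tx k); rewrite (le_trans step)// -mulrA.
by rewrite ler_wpM2l//; have [] := inv k.
Unshelve. all: end_near. Qed.

(** * Passage to the limit and conclusion *)

Lemma distS_le_add {R : realType} {n} (S : set 'cV[R]_n) x y :
  S !=set0 -> distS S x <= enorm (x - y) + distS S y.
Proof.
move=> S0; apply/ler_addgt0Pr => e e0.
have [|z Sz yz] := distS_lt S y (distS S y + e) S0; first by rewrite ltrDl.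
rewrite (le_trans (distS_le _ _ _ Sz))// -(subrKA y) (le_trans (enormD _ _))//.
by rewrite -addrA lerD2l ltW.
Qed.

Lemma le_of_cvg0 {R : realType} (a : R) (u : nat -> R) :
  (forall k, a <= u k) -> u @ \oo --> 0 -> a <= 0.
Proof.
move=> au u0; have ul := cvg_lim (@Rhausdorff R) u0.
rewrite -ul; apply: limr_ge; first by apply/cvg_ex; exists 0.
by near=> k; apply: au.
Unshelve. all: end_near. Qed.

Theorem mainTheorem7 (R : realType) (n m p : nat)
  (F : 'cV[R]_n -> 'cV[R]_m) (L : 'M[R]_(p, n)) (xs : 'cV[R]_n)
  (delta L0 omega gamma C r : R) :
  (n <= m)%N ->
  C2 F ->
  (p <= n)%N -> \rank L = p ->
  xs \in Xstar F ->
  (* (A1) on Omega := B(x*, delta) *)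
  0 < gamma ->
  (forall x, x \in cball xs delta -> forall v : 'cV[R]_n,
     gamma * enorm v ^+ 2 <=
       enorm (jacF F x *m v) ^+ 2 + enorm (L *m v) ^+ 2) ->
  (* (A2) *)
  0 < delta < 1 -> 0 < L0 ->
  (forall x y, x \in cball xs delta -> y \in cball xs delta ->
     opnorm (jacF F x - jacF F y) <= L0 * enorm (x - y)) ->
  (* (A3) *)
  0 < omega ->
  (forall x, x \in cball xs delta ->
     omega * distS (Xstar F) x <= enorm ((jacF F x)^T *m F x)) ->
  (* (A4) *)
  0 < r <= 1 -> 0 <= C ->
  (forall x z, x \in cball xs delta -> z \in Xstar F -> z \in cball xs delta ->
     enorm ((jacF F x - jacF F z)^T *m F z)
       <= C * enorm (x - z) `^ (1 + r)) ->
  (* constant rank *)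
  (1 <= \rank (jacF F xs))%N ->
  (forall x, x \in cball xs delta -> \rank (jacF F x) = \rank (jacF F xs)) ->
  exists2 eps : R, 0 < eps &
  exists K : R,
  forall (x d : nat -> 'cV[R]_n),
    (* LMMSS with alpha_k = 1 and lambda_k = ||J_k^T F_k|| *)
    (forall k,
       let Jk := jacF F (x k) in
       let lam := enorm (Jk^T *m F (x k)) in
       (Jk^T *m Jk + lam *: (L^T *m L)) *m d k = - (Jk^T *m F (x k)) /\
       (lam = 0 -> d k = 0) /\
       x k.+1 = x k + d k) ->
    x 0%N \in cball xs eps ->
    (forall k, distS (Xstar F) (x k.+1) <= K * distS (Xstar F) (x k) `^ (1 + r)) /\
    (fun k => distS (Xstar F) (x k)) @ \oo --> 0 /\
    exists2 xbar : 'cV[R]_n,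
      xbar \in Xstar F /\ xbar \in cball xs (delta / 2) &
      x @ \oo --> xbar.
Proof.
move=> nm C2F pn rL Sxs gamma0 A1 d01 L00 A2 om0 A3 r01 C0 A4 rk1 rk.
move/set_mem: Sxs => Sxs.
have A1' x : enorm (x - xs) <= delta -> forall v : 'cV[R]_n,
    gamma * enorm v ^+ 2 <= enorm (jacF F x *m v) ^+ 2 + enorm (L *m v) ^+ 2.
  by move=> xd; apply: A1; rewrite in_cball.
have A2' x y : enorm (x - xs) <= delta -> enorm (y - xs) <= delta ->
    opnorm (jacF F x - jacF F y) <= L0 * enorm (x - y).
  by move=> xd yd; apply: A2; rewrite in_cball.
have A3' x : enorm (x - xs) <= delta ->
    omega * distS (Xstar F) x <= enorm ((jacF F x)^T *m F x).
  by move=> xd; apply: A3; rewrite in_cball.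
have A4' x z : enorm (x - xs) <= delta -> Xstar F z -> enorm (z - xs) <= delta ->
    enorm ((jacF F x - jacF F z)^T *m F z) <= C * enorm (x - z) `^ (1 + r).
  by move=> xd Sz zd; apply: A4; rewrite ?in_cball//; apply: mem_set.
have rk' x : enorm (x - xs) <= delta -> \rank (jacF F x) = \rank (jacF F xs).
  by move=> xd; apply: rk; rewrite in_cball.
have [rho0 [c1 [K [rho00 c10 K0 step]]]] := lmmss_local_step _ _ _ _ _ _ _ _ _
  C2F Sxs gamma0 A1' d01 L00 A2' om0 A3' r01 C0 A4' rk'.
have [M M0 [_ MT]] := C2_local_bounds _ _ _ _ C2F d01 L00 A2'.
have /andP[d0 _] := d01; have /andP[r0 _] := r01.
(* The cap [delta / 2] confines the iterates, hence their limit, to the ball in the conclusion. *)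
pose rho := Num.min rho0 (delta / 2).
have rho_gt0 : 0 < rho by rewrite lt_min rho00 divr_gt0.
have rho_le : rho <= rho0 by rewrite ge_min lexx.
have rho_d : rho <= delta / 2 by rewrite ge_min lexx orbT.
pose T (x y : 'cV[R]_n) := exists d : 'cV[R]_n,
  let J := jacF F x in let lam := enorm (J^T *m F x) in
  [/\ (J^T *m J + lam *: (L^T *m L)) *m d = - (J^T *m F x),
      lam = 0 -> d = 0 & y = x + d].
have Tstep x y : enorm (x - xs) <= rho -> T x y ->
    enorm (y - x) <= c1 * distS (Xstar F) x /\
    distS (Xstar F) y <= K * distS (Xstar F) x `^ (1 + r).
  move=> xrho [d [eqd lam0 ->]]; rewrite addrAC subrr add0r.
  exact: step (le_trans xrho rho_le) eqd lam0.
have [eps eps0 conv] := superlinear_iteration _ _ T _ _ _ _ Sxs rho_gt0 c10 K0 r0 Tstep.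
exists eps => //; exists K => x d Hx; rewrite in_cball => x0.
have Tx k : T (x k) (x k.+1) by have [eqd [lam0 xS]] := Hx k; exists (d k).
have [xrho D0 [l xl]] := conv x Tx x0.
split; first by move=> k; have [] := Tstep _ _ (xrho k) (Tx k).
split=> //; exists l => //.
have lx0 := enorm_cvg0 _ _ xl.
have S0 : Xstar F !=set0 by exists xs.
have ld : enorm (l - xs) <= delta / 2.
  rewrite -subr_le0; apply: le_of_cvg0 lx0 => k; rewrite lerBlDr -(subrKA (x k)).
  by rewrite (le_trans (enormD _ _))// lerD2l (le_trans (xrho k)).
have Dl : distS (Xstar F) l = 0.
  apply/eqP; rewrite eq_le distS_ge0 andbT.
  apply: (le_of_cvg0 _ (fun k => enorm (l - x k) + distS (Xstar F) (x k))).
    by move=> k; exact: distS_le_add.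
  by rewrite -(addr0 0); apply: cvgD.
split; last by rewrite in_cball.
(* Distance zero yields membership through the bound of the gradient by [M] times the distance,
   which forces the gradient at [l] to vanish. *)
apply/mem_set/enorm_eq0/eqP; rewrite eq_le enorm_ge0 andbT.
rewrite -(mulr0 M) -Dl; apply: (gradient_le_distS _ xs _ delta) => // [z lz|].
  by have [] := MT z l lz.
by rewrite Dl; lra.
Qed.
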